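(* Let $C\subset N$ and let $\beta$ be an integer with $1<\beta<|C|$ such that $\sum_{j\in C}x_j\leq\beta$ is valid for the knapsack polytope, and suppose that $\gamma:=|C|$ is odd. Then there is no dominance relation between SCILS and CILS: SCILS does not dominate CILS, and CILS does not dominate SCILS.
   Context: Let $N=\{1,\ldots,n\}$, let $w\in\mathbb{Z}^n$ have positive entries, and let $c$ be a positive integer with $c\geq w_i$ for all $i\in N$. The knapsack polytope is the convex hull of $\{x\in\{0,1\}^n : w^Tx\leq c\}$. $\mathbb{S}^n$ is the set of real symmetric $n\times n$ matrices; the variable $X\in\mathbb{S}^n$ represents $xx^T$. For $C,\beta$ as in the claim, the cover inequality in the lifted space (CILS) derived from $\sum_{j\in C}x_j\leq\beta$ is $$\sum_{i,j\in C,\ i<j}X_{ij}\leq\binom{\beta}{2}.$$ For $|C|$ odd, the set of cover inequalities in the lifted space (SCILS) derived from $\sum_{j\in C}x_j\leq\beta$ is the set of all inequalities $$\sum_{(i,j)\in C_s}X_{ij}\leq\left\lfloor\frac{\beta}{2}\right\rfloor,$$ where, if $\beta$ is odd, $C_s=\{(i_1,j_1),\ldots,(i_p,j_p)\}$ ranges over all partitions of $C\setminus\{i_0\}$ into pairs, for all $i_0\in C$; and, if $\beta$ is even, $C_s=\{(i_0,i_0),(i_1,j_1),\ldots,(i_p,j_p)\}$, where $\{(i_1,j_1),\ldots,(i_p,j_p)\}$ ranges over all partitions of $C\setminus\{i_0\}$ into pairs, for all $i_0\in C$. In all cases $i_k<j_k$ for $k=1,\ldots,p$. A set of inequalities dominates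 another set of inequalities if every entrywise nonnegative $X\in\mathbb{S}^n$ that satisfies all inequalities of the first set also satisfies all inequalities of the second. *)

(* Defs.v *)
From HB Require Import structures.
From mathcomp Require Import all_boot all_order all_algebra.
From mathcomp Require Import boolp classical_sets reals convex.

Set Implicit Arguments.
Unset Strict Implicit.
Unset Printing Implicit Defensive.

Import Order.TTheory GRing.Theory Num.Theory.

Local Open Scope classical_set_scope.
Local Open Scope ring_scope.

Definition convex_hull (R : realType) (M : lmodType R) (A : set M) : set M :=
  smallest (@convex_set R M) A.

Definition knapsack_set (R : realType) (n : nat) (w : 'cV[int]_n) (c : int) :
    set 'cV[R]_n :=
  [set x : 'cV[R]_n | (forall i, x i 0 = 0 \/ x i 0 = 1) /\
           \sum_(i < n) (w i 0)%:~R * x i 0 <= c%:~R].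
Arguments knapsack_set R {n} w c.

Definition knapsack_polytope (R : realType) (n : nat) (w : 'cV[int]_n)
    (c : int) : set 'cV[R]_n :=
  convex_hull (knapsack_set R w c).
Arguments knapsack_polytope R {n} w c.

Definition cover_valid (R : realType) (n : nat) (w : 'cV[int]_n) (c : int)
    (C : {set 'I_n}) (beta : nat) : Prop :=
  knapsack_polytope R w c `<=`
    [set x : 'cV[R]_n | \sum_(j in C) x j 0 <= beta%:R].

(* The unordered pair {i, j} is encoded by the ordered pair (i, j) with i < j;
   the encoding is then injective, so sums over S count every pair once. *)
Definition pairing (n : nat) (D : {set 'I_n}) (S : {set 'I_n * 'I_n}) : bool :=
  [forall p in S, (p.1 < p.2)%N] &&
  finset.partition [set [set p.1; p.2] | p in S]%SET D.

Definition scils_support (n : nat) (C : {set 'I_n}) (beta : nat)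
    (Cs : {set 'I_n * 'I_n}) : Prop :=
  exists i0 S, [/\ i0 \in C, pairing (C :\ i0)%SET S &
    Cs = if odd beta then S else ((i0, i0) |: S)%SET].

(* An inequality in the lifted space is represented by the set of matrices
   that satisfy it, and a family of inequalities by a set of such sets. *)
Definition CILS (R : realType) (n : nat) (C : {set 'I_n}) (beta : nat) :
    set (set 'M[R]_n) :=
  [set [set X : 'M[R]_n |
     \sum_(i in C) \sum_(j in C | (i < j)%N) X i j <= 'C(beta, 2)%:R]].
Arguments CILS R {n} C beta.

(* Only meaningful for #|C| odd: otherwise C minus a point has no partition
   into pairs, and the family is empty. *)
Definition SCILS (R : realType) (n : nat) (C : {set 'I_n}) (beta : nat) :
    set (set 'M[R]_n) :=
  [set [set X : 'M[R]_n | \sum_(p in Cs) X p.1 p.2 <= (beta %/ 2)%:R]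
     | Cs in scils_support C beta].
Arguments SCILS R {n} C beta.

Definition dominates (R : realType) (n : nat) (I J : set (set 'M[R]_n)) :
    Prop :=
  forall X : 'M[R]_n, X^T = X -> (forall i j, 0 <= X i j) ->
    (forall q, I q -> q X) -> forall q, J q -> q X.

(* Main.v *)
Require Import Defs.
From mathcomp Require Import all_boot all_order all_algebra.
From mathcomp Require Import boolp classical_sets reals convex.
From mathcomp Require Import zify.

(** Neither family dominates the other, because one bounds a total over all
    pairs of [C] while the other bounds totals over single perfect matchings.

    - A uniform matrix escapes [CILS].  Put the value [t] in every off-diagonal
      entry and [0] on the diagonal.  With [p = (#|C| - 1) / 2], each matching of
      [C] minus a point has [p] pairs, so [t = (beta %/ 2) / p] makes every
      inequality of [SCILS] tight.  But [C] has [#|C| * p] pairs altogether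
      ([card_pairs_in]), of total weight [#|C| * (beta %/ 2)], whereas
      ['C(beta, 2) <= beta * (beta %/ 2)] and [beta < #|C|].

    - A concentrated matrix escapes [SCILS].  Put all the weight in one entry
      (and its mirror image).  If [beta] is even, a diagonal entry is invisible
      to [CILS] but occurs in an inequality of [SCILS], so any weight above
      [beta %/ 2] will do.  If [beta] is odd, a pair taken from a matching may
      carry the whole weight ['C(beta, 2)], which exceeds [beta %/ 2] because
      [beta >= 3].

    The uniform matrix relies on the number of pairs of a matching
    ([card_pairing]); the concentrated one relies on a matching to exist
    ([pairing_exists]), since otherwise [SCILS] would be empty. *)

Set Implicit Arguments.
Unset Strict Implicit.
Unset Printing Implicit Defensive.

Import Order.TTheory GRing.Theory Num.Theory.

Local Open Scope ring_scope.

Section UnorderedPairs.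

Variable n : nat.
Implicit Types (i j a b : 'I_n) (p : 'I_n * 'I_n) (C D : {set 'I_n}).
Implicit Types (S : {set 'I_n * 'I_n}).

Lemma set2_ord_inj i j a b : (i <= j)%N -> (a <= b)%N ->
  ([set i; j] == [set a; b])%SET = ((i, j) == (a, b)).
Proof.
move=> le_ij le_ab; apply/eqP/eqP => [eq_set|[-> ->]] //.
have: (i \in [set a; b])%SET by rewrite -eq_set set21.
have: (j \in [set a; b])%SET by rewrite -eq_set set22.
have: (a \in [set i; j])%SET by rewrite eq_set set21.
have: (b \in [set i; j])%SET by rewrite eq_set set22.
rewrite !inE -!val_eqE /= => hb ha hj hi.
by congr (_, _); apply/val_inj => /=; lia.
Qed.

Definition pairs_in C : {set 'I_n * 'I_n} :=
  [set p | [&& p.1 \in C, p.2 \in C & (p.1 < p.2)%N]]%SET.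

Lemma set2_inj_lt S : {in S, forall p : 'I_n * 'I_n, (p.1 < p.2)%N} ->
  {in S &, injective (fun p => [set p.1; p.2]%SET)}.
Proof.
move=> ltS [i j] [a b] /ltS/= lt_ij /ltS/= lt_ab /eqP.
by rewrite set2_ord_inj ?(ltnW lt_ij) ?(ltnW lt_ab) // => /eqP.
Qed.

(** The ordered pairs in [pairs_in C] encode the two-element subsets of [C]. *)
Lemma card_pairs_in C : #|pairs_in C| = 'C(#|C|, 2).
Proof.
rewrite -cards_draws -(@card_in_imset _ _ (fun p => [set p.1; p.2]%SET));
  last first.
  by apply: set2_inj_lt => p; rewrite inE => /and3P[].
congr #|pred_of_set _|; apply/setP=> A; apply/imsetP/idP.
  case=> -[i j]; rewrite !inE /= => /and3P[iC jC lt_ij] ->.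
  by rewrite finset.subUset !finset.sub1set iC jC cards2 -val_eqE /= neq_ltn lt_ij.
rewrite inE => /andP[sAC /cards2P[x [y [neq_xy defA]]]].
have xC : x \in C by rewrite (fintype.subsetP sAC) // defA set21.
have yC : y \in C by rewrite (fintype.subsetP sAC) // defA set22.
have [lt_xy|lt_yx|/val_inj eq_xy] := ltngtP x y.
- by exists (x, y); rewrite // inE xC yC.
- by exists (y, x); rewrite ?inE ?xC ?yC // defA finset.setUC.
- by rewrite eq_xy eqxx in neq_xy.
Qed.

Lemma card_pairing D S : pairing D S -> #|D| = (#|S| * 2)%N.
Proof.
case/andP=> /forall_inP ltS partS.
rewrite -(card_in_imset (set2_inj_lt ltS)).
apply: card_uniform_partition partS => _ /imsetP[p pS ->].
by rewrite cards2 -val_eqE /= neq_ltn ltS.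
Qed.

(** Two points of [D] are matched together and the rest by induction; they are
    swapped if necessary, since a pair must list its smaller index first. *)
Lemma pairing_exists D : ~~ odd #|D| -> exists S, pairing D S.
Proof.
have [m] := ubnP #|D|; elim: m D => // m IHm D leDm evenD.
have [->|[x xD]] := finset.set_0Vmem D.
  exists finset.set0; rewrite /pairing imset0 partition_set0 eqxx andbT.
  by apply/forall_inP => p; rewrite inE.
have /card_gt0P[y yDx] : (0 < #|D :\ x|)%N.
  by move: evenD; rewrite (cardsD1 x D) xD; case: #|D :\ x|%SET.
have cardD : #|D| = #|(D :\ x :\ y)%SET|.+2.
  by rewrite (cardsD1 x D) xD (cardsD1 y (D :\ x)%SET) yDx.
have [||S /andP[/forall_inP ltS partS]] := IHm (D :\ x :\ y)%SET.
- by rewrite cardD in leDm; apply: ltnW.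
- by move: evenD; rewrite cardD /= negbK.
have neq_xy : x != y by move: yDx; rewrite !inE eq_sym => /andP[].
have yD : y \in D by move: yDx; rewrite !inE => /andP[].
pose q := if (x < y)%N then (x, y) else (y, x).
have lt_q : (q.1 < q.2)%N.
  rewrite /q; case: (ltngtP x y) => //= /val_inj eq_xy.
  by rewrite eq_xy eqxx in neq_xy.
have set_q : ([set q.1; q.2] = [set x; y])%SET.
  by rewrite /q; case: ifP => //= _; rewrite finset.setUC.
exists (q |: S)%SET; apply/andP; split.
  by apply/forall_inP => p /finset.setU1P[->|/ltS].
have -> : D = ([set x; y] :|: (D :\ x :\ y))%SET.
  by apply/setP=> z; rewrite !inE; case: eqVneq => [->|_] //=;
    case: eqVneq => [->|_].
rewrite imsetU1 set_q; apply: partitionU1 => //.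
  by apply/finset.set0Pn; exists x; rewrite set21.
by rewrite -finset.setI_eq0; apply/eqP/setP => z; rewrite !inE; do 2!case: eqP.
Qed.

End UnorderedPairs.

Section Witnesses.

Variables (R : realType) (n : nat).
Implicit Types (i j a b : 'I_n) (C : {set 'I_n}) (X : 'M[R]_n) (t v : R).

Lemma sum_pairs_in C X :
  \sum_(i in C) \sum_(j in C | (i < j)%N) X i j =
  \sum_(p in pairs_in C) X p.1 p.2.
Proof. by rewrite pair_big_dep; apply: eq_bigl => p; rewrite inE. Qed.

Definition uniform_mx t : 'M[R]_n := \matrix_(i, j) (t *+ (i != j)).

Lemma sum_uniform_mx t (S : {set 'I_n * 'I_n}) :
  {in S, forall p : 'I_n * 'I_n, (p.1 < p.2)%N} ->
  \sum_(p in S) uniform_mx t p.1 p.2 = t *+ #|S|.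
Proof.
move=> ltS; rewrite -sumr_const; apply: eq_bigr => p /ltS lt_p.
by rewrite mxE -val_eqE neq_ltn lt_p.
Qed.

(** Comparing the index pairs as unordered sets makes the matrix symmetric, and
    covers the diagonal case [a = b] as well. *)
Definition entry_mx a b v : 'M[R]_n :=
  \matrix_(i, j) (v *+ ([set i; j] == [set a; b])%SET).

Lemma entry_mx_ge0 a b v i j : 0 <= v -> 0 <= entry_mx a b v i j.
Proof. by move=> v_ge0; rewrite mxE mulrn_wge0. Qed.

Lemma entry_mx_sym a b v : (entry_mx a b v)^T = entry_mx a b v.
Proof. by apply/matrixP => i j; rewrite !mxE finset.setUC. Qed.

Lemma sum_pairs_entry_mx C a b v : (a <= b)%N ->
  \sum_(p in pairs_in C) entry_mx a b v p.1 p.2 = v *+ ((a, b) \in pairs_in C).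
Proof.
move=> le_ab; transitivity (\sum_(q in pairs_in C) v *+ (q == (a, b))).
  apply: eq_bigr => -[i j]; rewrite inE => /and3P[_ _ /ltnW le_ij].
  by rewrite mxE set2_ord_inj.
have [abC|abNC] := boolP ((a, b) \in pairs_in C); last first.
  by rewrite big1 // => q qC; case: eqP qC abNC => // -> ->.
by rewrite (big_setD1 _ abC) /= eqxx big1 ?addr0 // => q /finset.setD1P[/negPf->].
Qed.

Lemma le_sum_entry_mx a b v (S : {set 'I_n * 'I_n}) :
  0 <= v -> (a, b) \in S -> v <= \sum_(p in S) entry_mx a b v p.1 p.2.
Proof.
move=> v_ge0 abS; rewrite (big_setD1 _ abS) /= mxE eqxx lerDl.
by apply: sumr_ge0 => p _; apply: entry_mx_ge0.
Qed.

End Witnesses.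

Lemma bin2_le_mul_half m : ('C(m, 2) <= m * m./2)%N.
Proof.
rewrite bin2 -[leqRHS]doubleK half_leq // doubleMr leq_mul //.
by rewrite -{1}(odd_double_half m); case: (odd m) => //; apply: leq_pred.
Qed.

Section Domination.

Variables (R : realType) (n : nat) (C : {set 'I_n}) (beta : nat).
Hypotheses (beta_gt1 : (1 < beta)%N) (beta_lt : (beta < #|C|)%N).
Hypothesis C_odd : odd #|C|.

Lemma SCILS_not_dominates_CILS :
  ~ dominates (SCILS R C beta) (CILS R C beta).
Proof.
move=> dom.
set p := #|C|.-1./2; set m := beta./2.
have defC : #|C| = p.*2.+1 by rewrite /p; move: C_odd; lia.
have p_gt0 : (0 < p)%N by move: beta_lt beta_gt1; rewrite defC; lia.
have m_gt0 : (0 < m)%N by rewrite half_gt0.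
pose t : R := m%:R / p%:R.
have t_ge0 : 0 <= t by rewrite divr_ge0.
have tp : t *+ p = m%:R by rewrite -[LHS]mulr_natr divfK // pnatr_eq0 -lt0n.
have total : \sum_(i in C) \sum_(j in C | (i < j)%N) uniform_mx n t i j =
    (#|C| * m)%:R.
  rewrite sum_pairs_in sum_uniform_mx => [|q]; last by rewrite inE => /and3P[].
  by rewrite card_pairs_in bin2odd // -/p mulnC mulrnA tp -mulrnA mulnC.
have le_total : (#|C| * m <= 'C(beta, 2))%N.
  rewrite -(ler_nat R) -total.
  apply: (dom (uniform_mx n t) _ _ _ _ erefl) => [|i j|_ [Cs + <-]].
  - by apply/matrixP => i j; rewrite !mxE eq_sym.
  - by rewrite mxE mulrn_wge0.
  case=> i0 [S [i0C pairS ->]] /=; rewrite divn2 -/m -tp.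
  have ltS : {in S, forall q : 'I_n * 'I_n, (q.1 < q.2)%N}.
    by case/andP: pairS => /forall_inP.
  have <- : #|S| = p.
    by have := card_pairing pairS; have := cardsD1 i0 C; rewrite i0C; lia.
  case: (odd beta); first by rewrite sum_uniform_mx.
  rewrite big_setU1 /=; last by apply/negP => /ltS; rewrite ltnn.
  by rewrite mxE eqxx add0r sum_uniform_mx.
have := leq_trans le_total (bin2_le_mul_half beta).
by rewrite leq_pmul2r // leqNgt beta_lt.
Qed.

(** For odd [beta] the supports have no diagonal entry.  For even [beta] an
    off-diagonal entry may not do: when [beta = 2], the largest weight
    ['C(beta, 2)] that [CILS] allows it equals [beta %/ 2]. *)
Lemma CILS_not_dominates_SCILS :
  ~ dominates (CILS R C beta) (SCILS R C beta).
Proof.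
move=> dom.
have /card_gt0P[i0 i0C] : (0 < #|C|)%N by case: #|C| C_odd.
have [|S pairS] := @pairing_exists _ (C :\ i0)%SET.
  by move: C_odd; rewrite (cardsD1 i0 C) i0C.
pose Cs := if odd beta then S else ((i0, i0) |: S)%SET.
have suppCs : scils_support C beta Cs by exists i0, S.
(* The entry q lies in the support Cs, so it violates that inequality alone; its
   weight counts in the other family only when q is a pair of distinct indices
   of C. *)
suff [[a b] [v [abCs le_ab lt_v v_le]]] : exists (q : 'I_n * 'I_n) (v : nat),
    [/\ q \in Cs, (q.1 <= q.2)%N, (beta %/ 2 < v)%N &
        (v * (q \in pairs_in C) <= 'C(beta, 2))%N].
  have : \sum_(q in Cs) entry_mx a b v%:R q.1 q.2 <= (beta %/ 2)%:R :> R.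
    apply: (dom (entry_mx a b v%:R) (entry_mx_sym _ _ _) _ _ _
      (ex_intro2 _ _ Cs suppCs erefl)) => [i j|_ ->].
      exact: entry_mx_ge0.
    by rewrite /= sum_pairs_in sum_pairs_entry_mx // -mulrnA ler_nat.
  apply/negP; rewrite -ltNge (lt_le_trans _ (le_sum_entry_mx _ abCs)) //.
  by rewrite ltr_nat.
rewrite divn2; have [beta_odd|beta_even] := boolP (odd beta); last first.
  exists (i0, i0), beta./2.+1; split=> //=.
    by rewrite /Cs (negPf beta_even) setU11.
  by rewrite inE /= ltnn !andbF muln0.
have [q qS] : exists q, q \in S.
  have := card_pairing pairS; have := cardsD1 i0 C; rewrite i0C.
  move=> cardC cardS; apply/card_gt0P; lia.
exists q, 'C(beta, 2); split.
- by rewrite /Cs beta_odd.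
- by case/andP: pairS => /forall_inP/(_ q qS)/ltnW.
- by rewrite bin2odd //; nia.
- by case: (q \in _); rewrite ?muln1 ?muln0.
Qed.

End Domination.

Theorem theorem22 (R : realType) (n : nat) (w : 'cV[int]_n) (c : int)
    (w_gt0 : forall i, 0 < w i 0) (c_gt0 : 0 < c)
    (w_le_c : forall i, w i 0 <= c)
    (C : {set 'I_n}) (beta : nat)
    (beta_gt1 : (1 < beta)%N) (beta_lt : (beta < #|C|)%N)
    (valid : cover_valid R w c C beta) (C_odd : odd #|C|) :
  ~ dominates (SCILS R C beta) (CILS R C beta) /\
  ~ dominates (CILS R C beta) (SCILS R C beta).
Proof.
split; first exact: SCILS_not_dominates_CILS.
exact: CILS_not_dominates_SCILS.
Qed.
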